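(* Suppose that $v_j$ is a proper vertex in the cyclically ordered quiver $(Q,\sigma)$. Let $U$ be the unipotent companion of $Q$ with respect to a linear order $<$ associated to $\sigma$ such that $v_i<v_j$ for every $v_i\in \mathrm{In}(v_j)$. Then the matrix $M_Q(v_j,-1)\,U\,M_Q(v_j,-1)^T$ is a unipotent companion of $\mu_{v_j}(Q,\sigma)$.
   Context: A quiver is a finite directed graph with parallel edges (arrows) allowed and no oriented cycles of length 1 or 2; all vertices are mutable. Write $u\to v$ if there is at least one arrow from $u$ to $v$; $\mathrm{In}(v)=\{u: u\to v\}$, $\mathrm{Out}(v)=\{u: v\to u\}$. The exchange matrix $B_Q=(b_{uv})$ is the skew-symmetric matrix indexed by vertices with $b_{uv}=\#\{\text{arrows }u\to v\}-\#\{\text{arrows }v\to u\}$. Mutation $\mu_v(Q)$: (1) for each oriented path $u\to v\to w$ add a new arrow $u\to w$ (with multiplicity); (2) reverse all arrows incident to $v$; (3) remove oriented 2-cycles one at a time until none remain. A cyclic ordering $\sigma$ is a linear ordering up to cyclic shifts; the linear orderings in this class are associated to $\sigma$. Moving clockwise means moving in the increasing direction (wrapping around). A cyclically ordered quiver (COQ) $(Q,\sigma)$ is a quiver with a cyclic ordering of its vertices. An oriented path $u\to v\to w$ makes a right turn at $v$ if $u<v<w$ in some linear order associated to $\sigma$; $v$ is proper if every oriented path $u\to v\to w$ makes a right turn at $v$. A wiggle fixes $Q$ and transposes two vertices adjacent in the cyclic ordering and not joined by an arrow of $Q$; wiggle equivalence is the generated equivalence relation. To mutate $(Q,\sigma)$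 at a proper vertex $v$, replace $Q$ by $\mu_v(Q)$ and move $v$ clockwise, from its original position, past all elements of $\mathrm{In}(v)$ (each once) without passing any element of $\mathrm{Out}(v)$, with In and Out computed in the mutated quiver; all choices are wiggle equivalent, and $\mu_v(Q,\sigma)$ denotes the resulting wiggle equivalence class. The unipotent companion of a linearly ordered quiver $(Q,<)$ is the unipotent upper triangular matrix $U$ with $U^T-U=B_Q$, rows and columns written in the order $<$. A unipotent companion of a COQ $(Q,\sigma)$ is the unipotent companion of $(Q,<)$ for some $<$ associated to $\sigma$; a unipotent companion of a wiggle equivalence class is a unipotent companion of some COQ in it. Matrices are regarded as indexed by vertices: a vertex-indexed matrix is called a unipotent companion if it becomes one after simultaneously reordering its rows and columns according to the relevant linear order. For a vertex $v$ and $\varepsilon=\pm1$, $M_Q(v,\varepsilon)=J+E$, where $J$ is diagonal with $J_{vv}=-1$ and $J_{qq}=1$ for $q\ne v$, and $E=(e_{pq})$ has $v$-th column $e_{qv}=\max(0,-\varepsilon b_{qv})$ and all other columns zero. *)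

(* Defs.v *)
From Stdlib Require Import Relation_Operators.
From mathcomp Require Import all_boot all_order all_algebra.

Set Implicit Arguments.
Unset Strict Implicit.
Unset Printing Implicit Defensive.

Import Order.TTheory GRing.Theory Num.Theory.
Local Open Scope ring_scope.

(** * Quivers *)

(** The vertices are the elements of ['I_n], and [arr Q u w] is the number of
    arrows from [u] to [w].  The two conditions exclude oriented cycles of
    length 1 and 2. *)
Record quiver (n : nat) := Quiver {
  arr :> 'M[nat]_n;
  quiver_no_loop : [forall u, arr u u == 0%N];
  quiver_no_2cycle : [forall u, forall w, (arr u w == 0%N) || (arr w u == 0%N)]
}.

Definition arrow n (Q : quiver n) (u w : 'I_n) : bool := (0 < Q u w)%N.

Definition In_ n (Q : quiver n) (v : 'I_n) : {set 'I_n} := [set u | arrow Q u v].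
Definition Out_ n (Q : quiver n) (v : 'I_n) : {set 'I_n} := [set u | arrow Q v u].

Definition exchange_mx n (Q : quiver n) : 'M[int]_n :=
  \matrix_(u, w) ((Q u w)%:Z - (Q w u)%:Z).

(** ** Quiver mutation *)

Definition add_paths n (v : 'I_n) (A : 'M[nat]_n) : 'M[nat]_n :=
  \matrix_(u, w) (A u w + A u v * A v w)%N.

Definition reverse_at n (v : 'I_n) (A : 'M[nat]_n) : 'M[nat]_n :=
  \matrix_(u, w) if (u == v) || (w == v) then A w u else A u w.

(** Removing oriented 2-cycles one at a time until none remain leaves the
    truncated difference of the two opposite multiplicities. *)
Definition cancel_2cycles n (A : 'M[nat]_n) : 'M[nat]_n :=
  \matrix_(u, w) (A u w - A w u)%N.

Definition mutate_arr n (v : 'I_n) (A : 'M[nat]_n) : 'M[nat]_n :=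
  cancel_2cycles (reverse_at v (add_paths v A)).

Lemma mutate_no_loop n (v : 'I_n) (A : 'M[nat]_n) :
  [forall u, mutate_arr v A u u == 0%N].
Proof. by apply/forallP => u; rewrite mxE subnn. Qed.

Lemma mutate_no_2cycle n (v : 'I_n) (A : 'M[nat]_n) :
  [forall u, forall w, (mutate_arr v A u w == 0%N) || (mutate_arr v A w u == 0%N)].
Proof.
by apply/forallP => u; apply/forallP => w; rewrite !mxE !subn_eq0 leq_total.
Qed.

Definition mutate n (v : 'I_n) (Q : quiver n) : quiver n :=
  Quiver (mutate_no_loop v Q) (mutate_no_2cycle v Q).

(** * Linear and cyclic orderings of the vertices *)

(** A linear ordering is a duplicate-free [n.-tuple 'I_n], listing the vertices
    in increasing order. *)
Definition lin_lt n (s : n.-tuple 'I_n) (u w : 'I_n) : bool :=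
  (index u s < index w s)%N.

Definition cyclic_shifts n (s : n.-tuple 'I_n) : {set n.-tuple 'I_n} :=
  [set t : n.-tuple 'I_n | [exists k : 'I_n.+1, t == rot k s :> seq 'I_n]].

(** A cyclic ordering is the set of the linear orderings associated to it. *)
Record cyclic_order (n : nat) := CyclicOrder {
  assoc :> {set n.-tuple 'I_n};
  cyclic_orderP :
    [exists s : n.-tuple 'I_n, uniq s && (assoc == cyclic_shifts s)]
}.

(** * Cyclically ordered quivers *)

Definition coquiver (n : nat) : Type := (quiver n * cyclic_order n)%type.

Definition right_turn n (sigma : cyclic_order n) (u v w : 'I_n) : Prop :=
  exists2 s, s \in assoc sigma & lin_lt s u v && lin_lt s v w.

Definition proper_vertex n (C : coquiver n) (v : 'I_n) : Prop :=
  forall u w, arrow C.1 u v -> arrow C.1 v w -> right_turn C.2 u v w.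

(** Two vertices are adjacent in a cyclic ordering when they are the first two
    entries of some associated linear ordering. *)
Definition wiggle n (C D : coquiver n) : Prop :=
  C.1 = D.1 /\
  exists (s t : n.-tuple 'I_n) (x y : 'I_n) (l : seq 'I_n),
    [/\ s \in assoc C.2, s = x :: y :: l :> seq 'I_n,
        t \in assoc D.2, t = y :: x :: l :> seq 'I_n
      & ~~ arrow C.1 x y && ~~ arrow C.1 y x].

Definition wiggle_equiv n : coquiver n -> coquiver n -> Prop :=
  clos_refl_sym_trans (coquiver n) (@wiggle n).

(** [tau] is obtained from [sigma] by moving [v] clockwise past the vertices
    of [l1] and no others; here [In_] and [Out_] are to be taken in the mutated
    quiver [Q]. *)
Definition moved_clockwise n (Q : quiver n) (v : 'I_n)
    (sigma tau : cyclic_order n) : Prop :=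
  exists (s t : n.-tuple 'I_n) (l1 l2 : seq 'I_n),
    [/\ s \in assoc sigma /\ s = v :: l1 ++ l2 :> seq 'I_n,
        t \in assoc tau /\ t = l1 ++ v :: l2 :> seq 'I_n,
        forall u, u \in In_ Q v -> u \in l1
      & forall u, u \in Out_ Q v -> u \notin l1].

(** The wiggle equivalence class obtained by mutating at [v], as a predicate;
    it is meant for a proper vertex [v]. *)
Definition mutation_class n (v : 'I_n) (C D : coquiver n) : Prop :=
  exists2 tau, moved_clockwise (mutate v C.1) v C.2 tau
             & wiggle_equiv (mutate v C.1, tau) D.

(** * Unipotent companions *)

(** All matrices are indexed by the vertices; [reorder s A] is [A] with rows and
    columns written in the order [s]. *)
Definition reorder n (s : n.-tuple 'I_n) (A : 'M[int]_n) : 'M[int]_n :=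
  mxsub (tnth s) (tnth s) A.

Definition unipotent_upper n (U : 'M[int]_n) : Prop :=
  (forall i, U i i = 1) /\ (forall i j : 'I_n, (j < i)%N -> U i j = 0).

Definition linear_companion n (Q : quiver n) (s : n.-tuple 'I_n)
    (U : 'M[int]_n) : Prop :=
  unipotent_upper (reorder s U) /\
  (reorder s U)^T - reorder s U = reorder s (exchange_mx Q).

Definition coq_companion n (C : coquiver n) (U : 'M[int]_n) : Prop :=
  exists2 s, s \in assoc C.2 & linear_companion C.1 s U.

Definition class_companion n (K : coquiver n -> Prop) (U : 'M[int]_n) : Prop :=
  exists2 C, K C & coq_companion C U.

(** * The matrices [M_Q(v, eps)] *)

Definition J_mx n (v : 'I_n) : 'M[int]_n :=
  \matrix_(p, q) if p == q then (if p == v then -1 else 1) else 0.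

Definition E_mx n (Q : quiver n) (v : 'I_n) (eps : int) : 'M[int]_n :=
  \matrix_(p, q) if q == v then Num.max 0 (- eps * exchange_mx Q p v) else 0.

(** Only [eps = 1] and [eps = -1] are meaningful. *)
Definition M_mx n (Q : quiver n) (v : 'I_n) (eps : int) : 'M[int]_n :=
  J_mx v + E_mx Q v eps.

(* Main.v *)
Require Import Defs.
From mathcomp Require Import all_boot all_order all_algebra.
From mathcomp Require Import zify ring.

Set Implicit Arguments.
Unset Strict Implicit.
Unset Printing Implicit Defensive.

Import Order.TTheory GRing.Theory Num.Theory.
Local Open Scope ring_scope.

(** Write [M] for [M_mx Q v (-1)], [a_p] for the number of arrows from [p] to
    [v] and [c_p] for the number of arrows from [v] to [p].

    The skew-symmetric part needs no ordering: left multiplication by [M]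
    negates row [v] and adds [a_p] times the old row [v] to row [p], so
    [M *m B_Q *m M^T] is the exchange matrix of the mutated quiver
    ([exchange_mx_mutate]), and [U^T - U = B_Q] turns into the same identity for
    [M *m U *m M^T].

    The ordering enters through triangularity.  Cut the given linear order at
    [v] as [L ++ v :: R]; by hypothesis all of [In(v)] lies in [L].  If [q]
    is in [In(v)] and [p] in [Out(v)], then the path [q -> v -> p] turns right at
    [v], which excludes [q < p < v].  Hence inside [L] all elements of [Out(v)]
    precede all elements of [In(v)], and [L] can be cut as [L1 ++ L2] with
    [In(v)] inside [L2] and [Out(v)] disjoint from [L2] ([proper_cut]).  The new
    linear order is [L1 ++ v :: L2 ++ R].  Cyclically, [v] has moved clockwise
    past [R] and [L1], that is, past all of [Out(v)] and none of [In(v)]; in the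
    mutated quiver these two sets are exchanged, so this is the prescribed move.
    The triangularity of [M *m U *m M^T] in that order ([conj_M_mx_lower0])
    follows from the same two facts about [In(v)] and [Out(v)]. *)

(** * Linear orders inside a cyclic order *)

Lemma mem_uniq_tuple n (s : n.-tuple 'I_n) : uniq s -> forall x, x \in s.
Proof.
move=> s_uniq x.
have [y _||_ ->] := uniq_min_size (s2 := enum 'I_n) s_uniq.
- by rewrite mem_enum.
- by rewrite size_enum_ord size_tuple.
- by rewrite mem_enum.
Qed.

(** The linear order generating [sigma] is itself a rotation of [s], and
    rotations compose, so any associated linear order generates [sigma]. *)
Lemma assoc_cyclic_shifts n (sigma : cyclic_order n) (s : n.-tuple 'I_n) :
  s \in assoc sigma -> uniq s /\ assoc sigma = cyclic_shifts s.
Proof.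
case/existsP: (cyclic_orderP sigma) => s0 /andP[s0_uniq /eqP ->].
have size0 := size_tuple s0; have size1 := size_tuple s.
rewrite inE => /existsP[k /eqP s_def]; split; first by rewrite s_def rot_uniq.
have k_le := ltn_ord k.
apply/setP => t; rewrite !inE; apply/existsP/existsP => -[m /eqP ->].
  have m_le := ltn_ord m.
  have s0_def : s0 = rot (n - k) s :> seq 'I_n.
    have := rotK k s0; rewrite /rotr size_rot size0 -s_def.
    exact: esym.
  rewrite s0_def rot_add_mod size1; try lia.
  case: ifP => le; first by exists (inord (m + (n - k))); rewrite inordK //; lia.
  by exists (inord (m + (n - k) - n)); rewrite inordK //; lia.
have m_le := ltn_ord m.
rewrite s_def rot_add_mod size0; try lia.
case: ifP => le; first by exists (inord (m + k)); rewrite inordK //; lia.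
by exists (inord (m + k - n)); rewrite inordK //; lia.
Qed.

Lemma mem_cyclic_shifts_cat n (s t : n.-tuple 'I_n) (A B : seq 'I_n) :
  s = A ++ B :> seq 'I_n -> t = B ++ A :> seq 'I_n -> t \in cyclic_shifts s.
Proof.
move=> s_def t_def; rewrite inE; apply/existsP.
have A_lt : (size A < n.+1)%N.
  by have := size_tuple s; rewrite s_def size_cat ltnS => size_n; lia.
by exists (Ordinal A_lt); rewrite s_def t_def /= rot_size_cat.
Qed.

Lemma index_rot (T : eqType) (m : nat) (s : seq T) (x : T) :
  uniq s -> x \in s -> (m <= size s)%N ->
  index x (rot m s) =
    if (index x s < m)%N then (index x s + (size s - m))%N
    else (index x s - m)%N.
Proof.
move=> + + m_le; rewrite -{1 2 4 5 7}(cat_take_drop m s).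
rewrite /rot cat_uniq mem_cat !index_cat size_drop size_takel //.
case/and3P => _ /hasPn disj _ x_in.
have [x_take|x_take] := boolP (x \in take m s).
  have x_drop : x \notin drop m s.
    by apply: contraL x_take => /disj.
  rewrite (negPf x_drop).
  have := x_take; rewrite -index_mem size_takel // => ->.
  by rewrite addnC.
have x_drop : x \in drop m s by case/orP: x_in => //; rewrite (negPf x_take).
by rewrite x_drop ltnNge leq_addr /= addKn.
Qed.

(** Rotating a linear order cyclically permutes the three inequalities that a
    right turn can consist of, so a right turn forbids the opposite ones. *)
Lemma right_turnN n (sigma : cyclic_order n) (s : n.-tuple 'I_n)
    (u v w : 'I_n) :
  s \in assoc sigma -> right_turn sigma u v w ->
  ~~ (lin_lt s u w && lin_lt s w v).
Proof.
move=> /assoc_cyclic_shifts[s_uniq sigma_def] [t].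
rewrite sigma_def inE => /existsP[k /eqP t_def].
have s_size := size_tuple s; have k_lt := ltn_ord k.
have s_all := mem_uniq_tuple s_uniq.
have k_le : (k <= size s)%N by rewrite s_size.
rewrite /lin_lt t_def !index_rot // s_size.
have index_lt x : (index x s < size s)%N by rewrite index_mem.
have := index_lt u; have := index_lt v; have := index_lt w.
by do 3!case: ifP => ?; lia.
Qed.

Lemma index_insert (T : eqType) (v x : T) (A B : seq T) : x != v ->
  index x (A ++ v :: B) =
    (index x (A ++ B) + (size A <= index x (A ++ B)))%N.
Proof.
move=> xv; rewrite !index_cat /= eq_sym (negPf xv).
have [|_] := boolP (x \in A); last by rewrite leq_addr addn1 addnS.
by rewrite -index_mem ltnNge => /negPf ->; rewrite addn0.
Qed.

(** Two insertion points of [v] in the same sequence are compared through this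
    lemma: moving [v] keeps the relative order of the other entries. *)
Lemma ltn_index_insert (T : eqType) (v x y : T) (A B : seq T) :
  x != v -> y != v ->
  (index x (A ++ v :: B) < index y (A ++ v :: B))%N =
  (index x (A ++ B) < index y (A ++ B))%N.
Proof. by move=> xv yv; rewrite !index_insert //; lia. Qed.

Lemma ltn_index_pivot (T : eqType) (v x : T) (A B : seq T) : v \notin A ->
  (index x (A ++ v :: B) < index v (A ++ v :: B))%N = (x \in A).
Proof.
move=> vA; rewrite !index_cat (negPf vA) /= eqxx addn0.
by case: ifPn; rewrite ?index_mem // ltnNge leq_addr.
Qed.

Lemma ltn_pivot_index (T : eqType) (v x : T) (A B : seq T) :
  v \notin A -> x != v ->
  (index v (A ++ v :: B) < index x (A ++ v :: B))%N = (x \notin A).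
Proof.
move=> vA xv; rewrite !index_cat (negPf vA) /= eqxx addn0.
rewrite [v == x]eq_sym (negPf xv).
case: ifPn => xA; last by rewrite addnS ltnS leq_addr.
by rewrite ltnNge ltnW // index_mem.
Qed.

(** * Quivers and their exchange matrices *)

Lemma quiver_loop0 n (Q : quiver n) u : Q u u = 0%N.
Proof. by have /forallP/(_ u)/eqP := quiver_no_loop Q. Qed.

Lemma quiver_2cycle0 n (Q : quiver n) u w : (Q u w = 0 \/ Q w u = 0)%N.
Proof.
have /forallP/(_ u)/forallP/(_ w)/orP := quiver_no_2cycle Q.
by case=> /eqP; [left | right].
Qed.

Lemma In_mutate n (Q : quiver n) (v u : 'I_n) :
  u \in In_ (mutate v Q) v -> u \in Out_ Q v.
Proof.
rewrite !inE /arrow !mxE eqxx orbT quiver_loop0 /=; lia.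
Qed.

Lemma Out_mutate n (Q : quiver n) (v u : 'I_n) :
  u \in Out_ (mutate v Q) v -> u \in In_ Q v.
Proof.
rewrite !inE /arrow !mxE eqxx orbT quiver_loop0 /=; lia.
Qed.

(** The coefficient is [Q p v] because a quiver without 2-cycles has
    [max (0, b_pv)] equal to the number of arrows from [p] to [v]. *)
Lemma M_mxE n (Q : quiver n) (v p q : 'I_n) :
  M_mx Q v (-1) p q =
    (-1) ^+ (p == v) * (p == q)%:R + (Q p v)%:Z * (q == v)%:R.
Proof.
rewrite !mxE opprK mul1r.
have -> : Num.max 0 ((Q p v)%:Z - (Q v p)%:Z) = (Q p v)%:Z.
  by case: (quiver_2cycle0 Q p v) => ->; lia.
by case: (p == q); case: (p == v); case: (q == v); rewrite /= ?expr1 ?expr0; ring.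
Qed.

Lemma mul_M_mx n (Q : quiver n) (v p q : 'I_n) (A : 'M[int]_n) :
  (M_mx Q v (-1) *m A) p q = (-1) ^+ (p == v) * A p q + (Q p v)%:Z * A v q.
Proof.
rewrite mxE; under eq_bigr => k _ do rewrite M_mxE mulrDl.
rewrite big_split /= (bigD1 p) //= big1 => [|k kp]; last first.
  by rewrite [p == k]eq_sym (negPf kp) mulr0 mul0r.
rewrite (bigD1 v) //= big1 => [|k /negPf ->]; last by rewrite mulr0 mul0r.
by rewrite !eqxx !mulr1 !addr0.
Qed.

Lemma conj_M_mx n (Q : quiver n) (v p q : 'I_n) (A : 'M[int]_n) :
  (M_mx Q v (-1) *m A *m (M_mx Q v (-1))^T) p q =
    (-1) ^+ (p == v) * ((-1) ^+ (q == v) * A p q + (Q q v)%:Z * A p v)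
    + (Q p v)%:Z * ((-1) ^+ (q == v) * A v q + (Q q v)%:Z * A v v).
Proof.
rewrite -mulmxA mul_M_mx.
have mulr_M k : (A *m (M_mx Q v (-1))^T) k q =
    (-1) ^+ (q == v) * A k q + (Q q v)%:Z * A k v.
  by rewrite -[A]trmxK -trmx_mul mxE mul_M_mx !mxE.
by rewrite !mulr_M.
Qed.

Lemma exchange_mx_mutate n (Q : quiver n) (v : 'I_n) :
  exchange_mx (mutate v Q) =
    M_mx Q v (-1) *m exchange_mx Q *m (M_mx Q v (-1))^T.
Proof.
apply/matrixP => p q; rewrite conj_M_mx !mxE.
have subn_subz (k m : nat) : (k - m)%N%:Z - (m - k)%N%:Z = k%:Z - m%:Z by lia.
rewrite subn_subz.
have [->|pv] := eqVneq p v; have [->|qv] := eqVneq q v;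
  rewrite /= ?quiver_loop0 ?expr0 ?expr1 ?PoszD ?PoszM; ring.
Qed.

(** * Companions in vertex-indexed form *)

Lemma linear_companionP n (Q : quiver n) (s : n.-tuple 'I_n) (U : 'M[int]_n) :
  uniq s ->
  linear_companion Q s U <->
  [/\ forall u, U u u = 1, forall u w, lin_lt s u w -> U w u = 0
    & U^T - U = exchange_mx Q].
Proof.
move=> s_uniq; have s_size := size_tuple s.
have s_all := mem_uniq_tuple s_uniq.
have rank_lt x : (index x s < n)%N by have := index_mem x s; rewrite s_all s_size.
pose rank x := Ordinal (rank_lt x).
have rankK x : tnth s (rank x) = x by rewrite (tnth_nth x) nth_index.
have index_tnth i : index (tnth s i) s = i.
  by rewrite (tnth_nth (tnth s i)) index_uniq // s_size.
split=> [[[diag low] skew] | [diag low skew]].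
  split=> [u|u w uw|].
  - by have := diag (rank u); rewrite mxE rankK.
  - by have := low (rank w) (rank u) uw; rewrite mxE !rankK.
  - apply/matrixP => u w; have /matrixP/(_ (rank u) (rank w)) := skew.
    by rewrite !mxE !rankK.
split; [split=> [i|i j ji]|].
- by rewrite mxE diag.
- by rewrite mxE low // /lin_lt !index_tnth.
- by rewrite -skew; apply/matrixP => i j; rewrite !mxE.
Qed.

(** * The new position of the mutated vertex *)

(** Cutting before the first element of [In(v)] works: an element of [Out(v)]
    between that element and [v] would give a path that does not turn right.
    Without elements of [In(v)] before [v], the cut is at [v] itself. *)
Lemma proper_cut n (Q : quiver n) (sigma : cyclic_order n) (v : 'I_n)
    (s : n.-tuple 'I_n) :
  proper_vertex (Q, sigma) v -> s \in assoc sigma ->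
  exists L1 L2 R : seq 'I_n,
    [/\ s = (L1 ++ L2) ++ v :: R :> seq 'I_n,
        forall u, u \in L1 -> u \notin In_ Q v
      & forall u, u \in L2 -> u \notin Out_ Q v].
Proof.
move=> v_proper s_sigma.
have [s_uniq _] := assoc_cyclic_shifts s_sigma.
have v_s := mem_uniq_tuple s_uniq v.
have [L [R s_def]] : exists L R, s = L ++ v :: R :> seq 'I_n.
  by case/splitPr: v_s => L R; exists L, R.
pose k := find (mem (In_ Q v)) L.
exists (take k L), (drop k L), R; rewrite cat_take_drop; split=> // u uL.
  apply/negP => u_In.
  have L_In : has (mem (In_ Q v)) L by apply/hasP; exists u; rewrite ?(mem_take uL).
  have := has_take k L_In; rewrite ltnn => /negP; apply.
  by apply/hasP; exists u.
apply/negP => u_Out.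
have L_In : has (mem (In_ Q v)) L.
  by rewrite has_find ltnNge; apply: contraL uL => ?; rewrite drop_oversize.
have k_lt : (k < size L)%N by rewrite -has_find.
have L_uniq : uniq L by move: s_uniq; rewrite s_def cat_uniq => /andP[].
pose q := nth v L k.
have q_In : q \in In_ Q v by apply: nth_find.
have q_L : q \in L by apply: mem_nth.
have u_L := mem_drop uL.
have /(right_turnN s_sigma) : right_turn sigma q v u.
  by apply: v_proper; [move: q_In | move: u_Out]; rewrite inE.
move/negP; apply; rewrite /lin_lt s_def; apply/andP; split; last first.
  rewrite ltn_index_pivot //.
  by move: s_uniq; rewrite s_def cat_uniq /= negb_or => /and3P[_ /andP[]].
rewrite !index_cat q_L u_L index_uniq // ltn_neqAle; apply/andP; split.
  apply/eqP => k_u.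
  have u_q : u = q by rewrite /q k_u nth_index.
  move: q_In u_Out; rewrite u_q !inE /arrow.
  by case: (quiver_2cycle0 Q q v) => ->.
rewrite leqNgt -in_take //.
have : uniq (take k L ++ drop k L) by rewrite cat_take_drop.
by rewrite cat_uniq => /and3P[_ /hasPn/(_ u uL)].
Qed.

(** * Triangularity of the conjugated companion *)

(** For [p] and [q] other than [v], the entry [U p q] is increased by
    [a_q * (U p v + a_p) + a_p * U v q].  The sum [U p v + a_p] equals [c_p] if
    [p] precedes [v] and vanishes otherwise ([U_col]), so with [q] before [p] the
    first product can be nonzero only if [q] is in [In(v)] and [p] in [Out(v)]
    with [q < p < v], which the cut into [L1] and [L2] rules out.  In the second,
    [a_p] nonzero gives [q < p < v], hence [U v q = 0]. *)
Lemma conj_M_mx_lower0 n (Q : quiver n) (v : 'I_n) (L1 L2 R : seq 'I_n)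
    (U : 'M[int]_n) :
  let lt u w :=
    (index u ((L1 ++ L2) ++ v :: R) < index w ((L1 ++ L2) ++ v :: R))%N in
  let lt' u w :=
    (index u (L1 ++ v :: L2 ++ R) < index w (L1 ++ v :: L2 ++ R))%N in
  v \notin L1 ++ L2 ->
  (forall u, u \in In_ Q v -> u \in L1 ++ L2) ->
  (forall u, u \in L1 -> u \notin In_ Q v) ->
  (forall u, u \in L2 -> u \notin Out_ Q v) ->
  (forall u, U u u = 1) -> (forall u w, lt u w -> U w u = 0) ->
  U^T - U = exchange_mx Q ->
  forall u w, lt' u w ->
    (M_mx Q v (-1) *m U *m (M_mx Q v (-1))^T) w u = 0.
Proof.
move=> lt lt' vL In_L L1_In L2_Out diag low skew q p qp.
have [vL1 vL2] : v \notin L1 /\ v \notin L2.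
  by apply/andP; rewrite -negb_or -mem_cat.
have ltv u : lt u v = (u \in L1 ++ L2) by rewrite /lt ltn_index_pivot.
have lt'v u : lt' u v = (u \in L1) by rewrite /lt' ltn_index_pivot.
have aL1 u : u \in L1 -> Q u v = 0%N.
  by move/L1_In; rewrite inE /arrow lt0n negbK => /eqP.
have cL2 u : u \in L2 -> Q v u = 0%N.
  by move/L2_Out; rewrite inE /arrow lt0n negbK => /eqP.
have aL u : u \notin L1 ++ L2 -> Q u v = 0%N.
  move=> uL; apply/eqP; rewrite -leqn0 leqNgt.
  by apply: contra uL => u_In; apply: In_L; rewrite inE.
have U_col u : u != v ->
    U u v + (Q u v)%:Z = if u \in L1 ++ L2 then (Q v u)%:Z else 0.
  move=> uv; case: ifPn => [uL | uL].
    have /matrixP/(_ u v) := skew; rewrite !mxE low ?ltv // sub0r => /eqP.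
    by rewrite eqr_oppLR opprB => /eqP ->; rewrite subrK.
  by rewrite aL // addr0 low // /lt ltn_pivot_index.
rewrite conj_M_mx diag.
have [pv | pv] := eqVneq p v.
  have qL1 : q \in L1 by rewrite -lt'v -pv.
  have qv : q != v by apply: contraNneq vL1 => <-.
  have Uvq : U v q = 0 by rewrite low // ltv mem_cat qL1.
  by rewrite pv (negPf qv) Uvq quiver_loop0 aL1 // !(mulr0, mul0r, addr0).
have [qv | qv] := eqVneq q v.
  have pL1 : p \notin L1 by move: qp; rewrite qv /lt' ltn_pivot_index.
  have Upv : U p v + (Q p v)%:Z = 0.
    rewrite U_col // mem_cat (negPf pL1) /=; case: ifP => // pL2.
    by rewrite cL2.
  rewrite qv quiver_loop0 diag expr0 expr1 -[RHS]oppr0 -Upv; ring.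
have lt_qp : lt q p.
  by move: qp; rewrite /lt /lt' !ltn_index_insert // catA.
have Qpv_Uvq : (Q p v)%:Z * U v q = 0.
  have [pL | pL] := boolP (p \in L1 ++ L2); last by rewrite aL // mul0r.
  by rewrite (low q v) ?mulr0 //; apply: ltn_trans lt_qp _; rewrite -/(lt p v) ltv.
have Qqv_Upv : (Q q v)%:Z * (U p v + (Q p v)%:Z) = 0.
  rewrite U_col // mem_cat; have [pL1 | _] := boolP (p \in L1).
    rewrite aL1 ?mul0r // -lt'v; apply: ltn_trans qp _.
    by rewrite -/(lt' p v) lt'v.
  by case: ifP => [/cL2 -> |]; rewrite mulr0.
transitivity ((Q p v)%:Z * U v q + (Q q v)%:Z * (U p v + (Q p v)%:Z)).
  by rewrite (low q p) // !expr0; ring.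
by rewrite Qpv_Uvq Qqv_Upv addr0.
Qed.

(** For [u] other than [v], the entry [U u u] is increased by
    [a_u * (U u v + U v u + a_u)].  If [a_u] is nonzero, then [u] precedes [v],
    so [U v u = 0] and [U u v = - a_u], and the increase vanishes. *)
Lemma conj_M_mx_diag1 n (Q : quiver n) (v : 'I_n) (s : n.-tuple 'I_n)
    (U : 'M[int]_n) :
  (forall u, u \in In_ Q v -> lin_lt s u v) ->
  (forall u, U u u = 1) -> (forall u w, lin_lt s u w -> U w u = 0) ->
  U^T - U = exchange_mx Q ->
  forall u, (M_mx Q v (-1) *m U *m (M_mx Q v (-1))^T) u u = 1.
Proof.
move=> In_lt diag low skew u; rewrite conj_M_mx !diag.
have [-> | uv] := eqVneq u v.
  by rewrite quiver_loop0 diag expr1; ring.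
have [Q_uv | Q_uv] := posnP (Q u v); first by rewrite Q_uv expr0; ring.
have lt_uv : lin_lt s u v by apply: In_lt; rewrite inE.
have Uuv : U u v = - (Q u v)%:Z.
  have /matrixP/(_ u v) := skew; rewrite !mxE low // sub0r.
  case: (quiver_2cycle0 Q u v) => Q0; first by rewrite Q0 in Q_uv.
  by rewrite Q0 subr0 => <-; rewrite opprK.
by rewrite (low u v) // Uuv expr0; ring.
Qed.

(** * The mutated companion *)

Theorem lemma4p1 (n : nat) (Q : quiver n) (sigma : cyclic_order n) (vj : 'I_n)
    (hproper : proper_vertex (Q, sigma) vj)
    (s : n.-tuple 'I_n) (hs : s \in assoc sigma)
    (hIn : forall vi : 'I_n, vi \in In_ Q vj -> lin_lt s vi vj)
    (U : 'M[int]_n) (hU : linear_companion Q s U) :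
  class_companion (mutation_class vj (Q, sigma))
    (M_mx Q vj (-1) *m U *m (M_mx Q vj (-1))^T).
Proof.
have [s_uniq sigma_def] := assoc_cyclic_shifts hs.
have [diag low skew] := (linear_companionP Q U s_uniq).1 hU.
have [L1 [L2 [R [s_def L1_In L2_Out]]]] := proper_cut hproper hs.
have vL : vj \notin L1 ++ L2.
  by move: s_uniq; rewrite s_def cat_uniq /= negb_or => /and3P[_ /andP[]].
have In_L u : u \in In_ Q vj -> u \in L1 ++ L2.
  by move/hIn; rewrite /lin_lt s_def ltn_index_pivot.
have size_n : size ((L1 ++ L2) ++ vj :: R) = n by rewrite -s_def size_tuple.
have size_s0 : size (vj :: (R ++ L1) ++ L2) == n.
  by rewrite -[X in _ == X]size_n /= !size_cat /= ?size_cat; apply/eqP; lia.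
have size_t : size ((R ++ L1) ++ vj :: L2) == n.
  by rewrite -[X in _ == X]size_n /= !size_cat /= ?size_cat; apply/eqP; lia.
have size_s' : size (L1 ++ vj :: L2 ++ R) == n.
  by rewrite -[X in _ == X]size_n /= !size_cat /= ?size_cat; apply/eqP; lia.
(* [s0] starts the associated linear order at [vj]; [t] is [s0] after moving
   [vj] past [R ++ L1]; [s'] is the rotation of [t] in which [L1] comes first
   again and which makes the new matrix triangular. *)
pose s0 : n.-tuple 'I_n := Tuple size_s0.
pose t : n.-tuple 'I_n := Tuple size_t.
pose s' : n.-tuple 'I_n := Tuple size_s'.
have s'_uniq : uniq s'.
  rewrite -(@perm_uniq _ s) // s_def /= -catA perm_cat2l.
  by rewrite (perm_catCA L2 [:: vj] R).
have tauP : [exists s1 : n.-tuple 'I_n,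
    uniq s1 && (cyclic_shifts s' == cyclic_shifts s1)].
  by apply/existsP; exists s'; rewrite s'_uniq eqxx.
pose tau := CyclicOrder tauP.
exists (mutate vj Q, tau).
  exists tau; last exact: Relation_Operators.rst_refl.
  exists s0, t, (R ++ L1), L2; split.
  - split=> //; rewrite sigma_def.
    by apply: mem_cyclic_shifts_cat s_def _; rewrite /= catA.
  - split=> //; apply: (@mem_cyclic_shifts_cat _ _ _ (L1 ++ vj :: L2) R).
      by rewrite /= -catA.
    by rewrite /= catA.
  - move=> u /In_mutate u_Out; have : u \in tval s := mem_uniq_tuple s_uniq u.
    rewrite s_def !mem_cat inE => /or3P[/orP[-> | /L2_Out] | /eqP uv | ->] //.
    + by rewrite orbT.
    + by rewrite u_Out.
    + by move: u_Out; rewrite uv inE /arrow quiver_loop0.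
  - move=> u /Out_mutate u_In; rewrite mem_cat negb_or andbC.
    rewrite (contraTN (L1_In u)) //=.
    move: s_uniq; rewrite s_def cat_uniq /= negb_or.
    move=> /and3P[_ /andP[_ /hasPn disj] _].
    by apply: contraL (In_L u u_In) => /disj.
exists s'; first by apply: (@mem_cyclic_shifts_cat _ _ _ [::] s'); rewrite ?cats0.
apply/linear_companionP => //; split.
- exact: conj_M_mx_diag1 hIn diag low skew.
- apply: conj_M_mx_lower0 vL In_L L1_In L2_Out diag _ skew => u w.
  by rewrite -s_def; apply: low.
- rewrite exchange_mx_mutate -skew mulmxBr mulmxBl.
  by rewrite !trmx_mul trmxK mulmxA.
Qed.
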